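(* Consider the comonad $\perp$ on $\mathrm{Bmod}$ with endofunctor $\perp M=M^2$, $\perp f=(f,f)$, counit $\epsilon_M:M^2\to M$, $\epsilon_M(x,y)=x$, and coproduct $\delta_M:M^2\to(M^2)^2$, $\delta_M(x,y)=(x,y,y,x)$. (i) The Kleisli category of the comonad $\perp$ is the category $\mathrm{Bmod}^2$ whose objects are $\mathbb B$-modules and whose morphisms $M\to N$ are pairs $(f,g)$ of morphisms $f,g:M\to N$ in $\mathrm{Bmod}$, with composition $$(f,g)\circ(f',g'):=(f\circ f'+g\circ g',\ f\circ g'+g\circ f').$$ (ii) The Eilenberg–Moore category of the comonad $\perp$ is the category $\mathrm{Bmod}^{\mathfrak s}$ of $\mathbb B$-modules endowed with an involution $\sigma$.
   Context: $\mathbb B=\{0,1\}$ is the Boolean semifield ($1+1=1$). A $\mathbb B$-module is a commutative monoid $(M,+,0)$ with $x+x=x$ for all $x$; morphisms are the monoid homomorphisms; the category is denoted $\mathrm{Bmod}$. Morphisms $M\to N$ are added pointwise. $\perp f=(f,f)$ means $(x,y)\mapsto(f(x),f(y))$. Morphisms in $\mathrm{Bmod}^{\mathfrak s}$ are the $\mathbb B$-module morphisms commuting with the involutions $\sigma$ ($\sigma$ an endomorphism with $\sigma^2=\mathrm{id}$). The Kleisli category of a comonad $\perp$ has the same objects, with morphisms $M\to N$ the morphisms $\perp M\to N$ and composition $b\circ_{Kl}a=b\circ\perp(a)\circ\delta$; the Eilenberg–Moore category is the category of coalgebras of the comonad. *)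

(* Defs.v *)
From HB Require Import structures.
From mathcomp Require Import all_boot ssralg.
From mathcomp Require Import boolp.

Set Implicit Arguments.
Unset Strict Implicit.
Unset Printing Implicit Defensive.

Import GRing.Theory.
Local Open Scope ring_scope.

(* Categories, with Leibniz equality of morphisms. *)

Declare Scope cat_scope.
Delimit Scope cat_scope with cat.

Record category := Category {
  obj :> Type;
  hom : obj -> obj -> Type;
  idc : forall x, hom x x;
  comp : forall x y z, hom y z -> hom x y -> hom x z;
  comp1c : forall x y (f : hom x y), comp (idc y) f = f;
  compc1 : forall x y (f : hom x y), comp f (idc x) = f;
  compcA : forall x y z t (h : hom z t) (g : hom y z) (f : hom x y),
    comp h (comp g f) = comp (comp h g) f }.

Arguments hom {c} x y.
Arguments idc {c} x.
Arguments comp {c x y z} g f.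

Notation "g \oc f" := (comp g f)
  (at level 50, left associativity) : cat_scope.
Local Open Scope cat_scope.

Definition functor_axioms (C D : category) (F0 : C -> D)
    (F1 : forall x y, hom x y -> hom (F0 x) (F0 y)) : Prop :=
  (forall x, F1 x x (idc x) = idc (F0 x)) /\
  (forall x y z (g : hom y z) (f : hom x y),
     F1 x z (g \oc f) = F1 y z g \oc F1 x y f).

Record functor (C D : category) := Functor {
  fobj :> C -> D;
  fmap : forall x y, hom x y -> hom (fobj x) (fobj y);
  functorP : functor_axioms fmap }.

Arguments Functor {C D} fobj fmap functorP.
Arguments fmap {C D} F {x y} f : rename.

Section FunctorTheory.
Variables (C D : category) (F : functor C D).

Lemma fmap1 x : fmap F (idc x) = idc (F x).
Proof. exact: (functorP F).1. Qed.

Lemma fmapM x y z (g : hom y z) (f : hom x y) :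
  fmap F (g \oc f) = fmap F g \oc fmap F f.
Proof. exact: (functorP F).2. Qed.

End FunctorTheory.

Fact id_functor_axioms (C : category) :
  @functor_axioms C C (fun x => x) (fun x y f => f).
Proof. by []. Qed.

Definition id_functor (C : category) : functor C C :=
  Functor (fun x => x) (fun x y f => f) (id_functor_axioms C).

Fact comp_functor_axioms (C D E : category) (G : functor D E)
    (F : functor C D) :
  @functor_axioms C E (fun x => G (F x)) (fun x y f => fmap G (fmap F f)).
Proof. by split=> *; rewrite ?fmap1 ?fmapM. Qed.

Definition comp_functor (C D E : category) (G : functor D E)
    (F : functor C D) : functor C E :=
  Functor (fun x => G (F x)) (fun x y f => fmap G (fmap F f))
    (comp_functor_axioms G F).

(* Isomorphism of categories (strict, not up to equivalence). *)
Definition cat_iso (C D : category) (F : functor C D) : Prop :=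
  exists G : functor D C,
    comp_functor G F = id_functor C /\ comp_functor F G = id_functor D.

Record comonad (C : category) := Comonad {
  cm_functor :> functor C C;
  counit : forall x, hom (cm_functor x) x;
  coprod : forall x, hom (cm_functor x) (cm_functor (cm_functor x));
  counit_nat : forall x y (f : hom x y),
    f \oc counit x = counit y \oc fmap cm_functor f;
  coprod_nat : forall x y (f : hom x y),
    fmap cm_functor (fmap cm_functor f) \oc coprod x =
    coprod y \oc fmap cm_functor f;
  coprodA : forall x,
    coprod (cm_functor x) \oc coprod x =
    fmap cm_functor (coprod x) \oc coprod x;
  counit_l : forall x, counit (cm_functor x) \oc coprod x = idc _;
  counit_r : forall x, fmap cm_functor (counit x) \oc coprod x = idc _ }.

Arguments counit {C} T x : rename.
Arguments coprod {C} T x : rename.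

Section Kleisli.
Variables (C : category) (T : comonad C).

Definition kl_hom (x y : C) : Type := hom (T x) y.

Definition kl_comp (x y z : C) (b : kl_hom y z) (a : kl_hom x y) :
  kl_hom x z := b \oc fmap T a \oc coprod T x.

Fact kl_comp1 x y (f : kl_hom x y) : kl_comp (counit T y) f = f.
Proof. by rewrite /kl_comp -counit_nat -compcA counit_l compc1. Qed.

Fact kl_compc1 x y (f : kl_hom x y) : kl_comp f (counit T x) = f.
Proof. by rewrite /kl_comp -compcA counit_r compc1. Qed.

Fact kl_compA x y z t (h : kl_hom z t) (g : kl_hom y z) (f : kl_hom x y) :
  kl_comp h (kl_comp g f) = kl_comp (kl_comp h g) f.
Proof.
rewrite /kl_comp !fmapM -!compcA; congr (_ \oc (_ \oc _)).
by rewrite -coprodA compcA coprod_nat -compcA.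
Qed.

Definition kleisli : category :=
  @Category C kl_hom (counit T) kl_comp kl_comp1 kl_compc1 kl_compA.

End Kleisli.

Lemma sval_inj (T : Type) (P : T -> Prop) (u v : {x : T | P x}) :
  sval u = sval v -> u = v.
Proof.
case: u v => x Px [y Py] /= xy; subst y.
by rewrite (Prop_irrelevance Px Py).
Qed.

Section EilenbergMoore.
Variables (C : category) (T : comonad C).

Record coalgebra := Coalgebra {
  coalg_obj : C;
  coaction : hom coalg_obj (T coalg_obj);
  coaction_counit : counit T coalg_obj \oc coaction = idc coalg_obj;
  coactionA :
    coprod T coalg_obj \oc coaction = fmap T coaction \oc coaction }.

Definition coalg_hom (A B : coalgebra) : Type :=
  {f : hom (coalg_obj A) (coalg_obj B) |
    coaction B \oc f = fmap T f \oc coaction A}.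

Fact coalg_id_subproof A :
  coaction A \oc idc (coalg_obj A) = fmap T (idc (coalg_obj A)) \oc coaction A.
Proof. by rewrite fmap1 comp1c compc1. Qed.

Definition coalg_id A : coalg_hom A A := exist _ _ (coalg_id_subproof A).

Fact coalg_comp_subproof (A B D : coalgebra) (g : coalg_hom B D)
    (f : coalg_hom A B) :
  coaction D \oc (sval g \oc sval f) =
  fmap T (sval g \oc sval f) \oc coaction A.
Proof. by rewrite fmapM compcA (svalP g) -compcA (svalP f) compcA. Qed.

Definition coalg_comp (A B D : coalgebra) (g : coalg_hom B D)
    (f : coalg_hom A B) : coalg_hom A D :=
  exist _ _ (coalg_comp_subproof g f).

Fact coalg_comp1 A B (f : coalg_hom A B) : coalg_comp (coalg_id B) f = f.
Proof. by apply: sval_inj; apply: comp1c. Qed.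

Fact coalg_compc1 A B (f : coalg_hom A B) : coalg_comp f (coalg_id A) = f.
Proof. by apply: sval_inj; apply: compc1. Qed.

Fact coalg_compA A B D E (h : coalg_hom D E) (g : coalg_hom B D)
    (f : coalg_hom A B) :
  coalg_comp h (coalg_comp g f) = coalg_comp (coalg_comp h g) f.
Proof. by apply: sval_inj; apply: compcA. Qed.

Definition eilenberg_moore : category :=
  @Category coalgebra coalg_hom coalg_id coalg_comp
    coalg_comp1 coalg_compc1 coalg_compA.

End EilenbergMoore.

(* Modules over the Boolean semifield: idempotent commutative monoids. *)

HB.mixin Record Nmodule_isBModule M of GRing.Nmodule M := {
  addrr_idem : forall x : M, x + x = x
}.

#[short(type="bModType")]
HB.structure Definition BModule := { M of Nmodule_isBModule M & GRing.Nmodule M }.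

Fact pair_addrr_idem (M N : bModType) (u : M * N) : u + u = u.
Proof. by case: u => x y; congr pair; apply: addrr_idem. Qed.

HB.instance Definition _ (M N : bModType) :=
  Nmodule_isBModule.Build (M * N)%type (@pair_addrr_idem M N).

Lemma additive_eq (M N : nmodType) (f g : {additive M -> N}) : f =1 g -> f = g.
Proof.
case: f g => f [[f_add]] [g [[g_add]]] /= /funext fg; subst g.
by rewrite (Prop_irrelevance f_add g_add).
Qed.

Definition bmod_id (M : bModType) : {additive M -> M} := @idfun M.

Definition bmod_comp (M N P : bModType) (g : {additive N -> P})
  (f : {additive M -> N}) : {additive M -> P} := g \o f.

Definition bmod_zero (M N : bModType) : {additive M -> N} := \0.

Definition bmod_add (M N : bModType) (f g : {additive M -> N}) :
  {additive M -> N} := f \+ g.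

Fact bmod_comp1 (M N : bModType) (f : {additive M -> N}) :
  bmod_comp (bmod_id N) f = f.
Proof. exact: additive_eq. Qed.

Fact bmod_compc1 (M N : bModType) (f : {additive M -> N}) :
  bmod_comp f (bmod_id M) = f.
Proof. exact: additive_eq. Qed.

Fact bmod_compA (M N P Q : bModType) (h : {additive P -> Q})
    (g : {additive N -> P}) (f : {additive M -> N}) :
  bmod_comp h (bmod_comp g f) = bmod_comp (bmod_comp h g) f.
Proof. exact: additive_eq. Qed.

Definition Bmod : category :=
  @Category bModType (fun M N : bModType => {additive M -> N})
    bmod_id bmod_comp bmod_comp1 bmod_compc1 bmod_compA.

Section SquareComonad.

Definition sqr_obj (M : bModType) : bModType := (M * M)%type.

Section Maps.
Variables (M N : bModType).

Section Map.
Variable f : {additive M -> N}.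

Definition sqr_fun (u : M * M) : N * N := (f u.1, f u.2).

Fact sqr_fun_nmod_morphism : nmod_morphism sqr_fun.
Proof. by split=> [|u v]; rewrite /sqr_fun /= ?raddf0 ?raddfD. Qed.

HB.instance Definition _ :=
  GRing.isNmodMorphism.Build (M * M)%type (N * N)%type sqr_fun
    sqr_fun_nmod_morphism.

End Map.

Definition sqr_counit_fun (u : M * M) : M := u.1.

Fact sqr_counit_nmod_morphism : nmod_morphism sqr_counit_fun.
Proof. by []. Qed.

HB.instance Definition _ :=
  GRing.isNmodMorphism.Build (M * M)%type M sqr_counit_fun
    sqr_counit_nmod_morphism.

Definition sqr_coprod_fun (u : M * M) : (M * M) * (M * M) :=
  ((u.1, u.2), (u.2, u.1)).

Fact sqr_coprod_nmod_morphism : nmod_morphism sqr_coprod_fun.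
Proof. by []. Qed.

HB.instance Definition _ :=
  GRing.isNmodMorphism.Build (M * M)%type ((M * M) * (M * M))%type
    sqr_coprod_fun sqr_coprod_nmod_morphism.

(* The two inclusions and the second projection, used to identify
   Hom (M^2, N) with Hom (M, N)^2 and to extract the involution of a
   coalgebra. *)
Definition inj1_fun (x : M) : M * M := (x, 0).
Definition inj2_fun (x : M) : M * M := (0, x).

Fact inj1_nmod_morphism : nmod_morphism inj1_fun.
Proof. by split=> // x y; congr pair; rewrite addr0. Qed.

Fact inj2_nmod_morphism : nmod_morphism inj2_fun.
Proof. by split=> // x y; congr pair; rewrite addr0. Qed.

HB.instance Definition _ :=
  GRing.isNmodMorphism.Build M (M * M)%type inj1_fun inj1_nmod_morphism.

HB.instance Definition _ :=
  GRing.isNmodMorphism.Build M (M * M)%type inj2_fun inj2_nmod_morphism.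

End Maps.

Definition sqr_map (M N : Bmod) (f : hom M N) :
  @hom Bmod (sqr_obj M) (sqr_obj N) := sqr_fun f.
Definition sqr_counit (M : Bmod) : @hom Bmod (sqr_obj M) M :=
  @sqr_counit_fun M.
Definition sqr_coprod (M : Bmod) :
  @hom Bmod (sqr_obj M) (sqr_obj (sqr_obj M)) := @sqr_coprod_fun M.
Definition inj1 (M : Bmod) : @hom Bmod M (sqr_obj M) := @inj1_fun M.
Definition inj2 (M : Bmod) : @hom Bmod M (sqr_obj M) := @inj2_fun M.
Definition proj2 (M : Bmod) : @hom Bmod (sqr_obj M) M := @snd M M.

Fact sqr_functor_axioms : @functor_axioms Bmod Bmod sqr_obj sqr_map.
Proof. by split=> *; apply: additive_eq => -[]. Qed.

Definition sqr_functor : functor Bmod Bmod :=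
  @Functor Bmod Bmod sqr_obj sqr_map sqr_functor_axioms.

Fact sqr_counit_nat (M N : Bmod) (f : hom M N) :
  f \oc sqr_counit M = sqr_counit N \oc fmap sqr_functor f.
Proof. exact: additive_eq. Qed.

Fact sqr_coprod_nat (M N : Bmod) (f : hom M N) :
  fmap sqr_functor (fmap sqr_functor f) \oc sqr_coprod M =
  sqr_coprod N \oc fmap sqr_functor f.
Proof. exact: additive_eq. Qed.

Fact sqr_coprodA (M : Bmod) :
  sqr_coprod (sqr_functor M) \oc sqr_coprod M =
  fmap sqr_functor (sqr_coprod M) \oc sqr_coprod M.
Proof. exact: additive_eq. Qed.

Fact sqr_counit_l (M : Bmod) :
  sqr_counit (sqr_functor M) \oc sqr_coprod M = idc _.
Proof. by apply: additive_eq => -[]. Qed.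

Fact sqr_counit_r (M : Bmod) :
  fmap sqr_functor (sqr_counit M) \oc sqr_coprod M = idc _.
Proof. by apply: additive_eq => -[]. Qed.

Definition sqr_comonad : comonad Bmod :=
  @Comonad Bmod sqr_functor sqr_counit sqr_coprod sqr_counit_nat
    sqr_coprod_nat sqr_coprodA sqr_counit_l sqr_counit_r.

End SquareComonad.

Section BmodPairs.

Definition bmod2_hom (M N : bModType) : Type :=
  ({additive M -> N} * {additive M -> N})%type.

Definition bmod2_id (M : bModType) : bmod2_hom M M := (bmod_id M, bmod_zero M M).

Definition bmod2_comp (M N P : bModType) (u : bmod2_hom N P)
    (v : bmod2_hom M N) : bmod2_hom M P :=
  (bmod_add (bmod_comp u.1 v.1) (bmod_comp u.2 v.2),
   bmod_add (bmod_comp u.1 v.2) (bmod_comp u.2 v.1)).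

Fact bmod2_comp1 (M N : bModType) (u : bmod2_hom M N) :
  bmod2_comp (bmod2_id N) u = u.
Proof.
by case: u => f g; congr pair; apply: additive_eq => x; rewrite /= addr0.
Qed.

Fact bmod2_compc1 (M N : bModType) (u : bmod2_hom M N) :
  bmod2_comp u (bmod2_id M) = u.
Proof.
case: u => f g; congr pair; apply: additive_eq => x /=; rewrite raddf0.
  exact: addr0.
exact: add0r.
Qed.

Fact bmod2_compA (M N P Q : bModType) (w : bmod2_hom P Q)
    (u : bmod2_hom N P) (v : bmod2_hom M N) :
  bmod2_comp w (bmod2_comp u v) = bmod2_comp (bmod2_comp w u) v.
Proof.
congr pair; apply: additive_eq => x /=; rewrite !raddfD -!addrA;
  by congr (_ + _); rewrite addrA addrC.
Qed.

Definition Bmod2 : category :=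
  @Category bModType bmod2_hom bmod2_id bmod2_comp
    bmod2_comp1 bmod2_compc1 bmod2_compA.

End BmodPairs.

Section BmodInvolution.

Record inv_bmod := InvBmod {
  inv_carrier : Bmod;
  inv_sigma : hom inv_carrier inv_carrier;
  inv_sigmaK : inv_sigma \oc inv_sigma = idc inv_carrier }.

Definition inv_hom (M N : inv_bmod) : Type :=
  {f : hom (inv_carrier M) (inv_carrier N) |
    f \oc inv_sigma M = inv_sigma N \oc f}.

Fact inv_id_subproof (M : inv_bmod) :
  idc (inv_carrier M) \oc inv_sigma M = inv_sigma M \oc idc (inv_carrier M).
Proof. by rewrite comp1c compc1. Qed.

Definition inv_id (M : inv_bmod) : inv_hom M M :=
  exist _ _ (inv_id_subproof M).

Fact inv_comp_subproof (M N P : inv_bmod) (g : inv_hom N P)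
    (f : inv_hom M N) :
  (sval g \oc sval f) \oc inv_sigma M = inv_sigma P \oc (sval g \oc sval f).
Proof. by rewrite compcA -(svalP g) -!compcA (svalP f). Qed.

Definition inv_comp (M N P : inv_bmod) (g : inv_hom N P) (f : inv_hom M N) :
  inv_hom M P := exist _ _ (inv_comp_subproof g f).

Fact inv_comp1 (M N : inv_bmod) (f : inv_hom M N) : inv_comp (inv_id N) f = f.
Proof. by apply: sval_inj; apply: comp1c. Qed.

Fact inv_compc1 (M N : inv_bmod) (f : inv_hom M N) : inv_comp f (inv_id M) = f.
Proof. by apply: sval_inj; apply: compc1. Qed.

Fact inv_compA (M N P Q : inv_bmod) (h : inv_hom P Q) (g : inv_hom N P)
    (f : inv_hom M N) :
  inv_comp h (inv_comp g f) = inv_comp (inv_comp h g) f.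
Proof. by apply: sval_inj; apply: compcA. Qed.

Definition Bmods : category :=
  @Category inv_bmod inv_hom inv_id inv_comp inv_comp1 inv_compc1 inv_compA.

End BmodInvolution.

(* A morphism h : M^2 -> N corresponds to the pair (f, g) for which
   h (x, y) = f x + g y. *)
Definition kleisli_pair (M N : Bmod) (h : kl_hom sqr_comonad M N) :
  bmod2_hom M N := (h \oc inj1 M, h \oc inj2 M).

(* The second component of a coaction M -> M^2, which is the involution. *)
Definition coalg_sigma (A : coalgebra sqr_comonad) :
  hom (coalg_obj A) (coalg_obj A) :=
  proj2 (coalg_obj A) \oc coaction A.

(* Main.v *)
Require Import Defs.
From mathcomp Require Import ssrfun.
From HB Require Import structures.
From mathcomp Require Import all_boot ssralg.
From mathcomp Require Import boolp.

Set Implicit Arguments.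
Unset Strict Implicit.
Unset Printing Implicit Defensive.

Import GRing.Theory.
Local Open Scope ring_scope.
Local Open Scope cat_scope.

(** A Kleisli morphism [h : M^2 -> N] is determined by its restrictions [f], [g]
    to the two summands of the biproduct [M^2], and
    [(b o T a o delta) (x, y) = b (a (x, y), a (y, x))], which gives the composition
    law of the pairs. For a coaction [c], the counit law says that
    [c x = (x, sigma x)] and coassociativity says that [sigma] is an involution. *)

(* Packaging an arrow with its endpoints avoids transporting arrows along
   equalities of objects. *)
Definition arrow (C : category) (x y : C) (f : hom x y) :
  {p : C * C & hom p.1 p.2} := existT (fun p : C * C => hom p.1 p.2) (x, y) f.

(** The second components agree up to transport along a proof of [(x, y) = (x, y)]; by proof
    irrelevance that proof is [erefl], so the transport vanishes. *)
Lemma arrow_inj (C : category) (x y : C) (f g : hom x y) :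
  arrow f = arrow g -> f = g.
Proof.
move=> fg; move: (projT2_eq fg).
by rewrite (Prop_irrelevance (projT1_eq fg) erefl).
Qed.

Lemma functor_ext (C D : category) (F G : functor C D) :
  (forall x y (f : hom x y), arrow (fmap F f) = arrow (fmap G f)) -> F = G.
Proof.
case: F G => [F0 F1 F_ax] [G0 G1 G_ax] /= FG.
have e0 : F0 = G0.
  (* The object maps are read off identities: the packaged image of [idc x] has [F0 x] as its
     source. *)
  by apply: funext => x; case: (congr1 (@projT1 _ _) (FG x x (idc x))).
subst G0.
have e1 : F1 = G1.
  apply: functional_extensionality_dep => x.
  apply: functional_extensionality_dep => y.
  by apply: funext => f; apply: arrow_inj.
by subst G1; rewrite (Prop_irrelevance F_ax G_ax).
Qed.

(** Serves the round trip through involutions, which keeps the carrier by conversion but the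
    coaction only up to a provable equality. Once the coactions are identified, the coalgebra laws
    agree by proof irrelevance. *)
Lemma coalg_arrow_eq (C : category) (T : comonad C) (A B : coalgebra T)
    (a : hom (coalg_obj A) (T (coalg_obj A))) a_counit aA
    (b : hom (coalg_obj B) (T (coalg_obj B))) b_counit bA
    (A' := @Coalgebra C T (coalg_obj A) a a_counit aA)
    (B' := @Coalgebra C T (coalg_obj B) b b_counit bA)
    (f : coalg_hom A B) (f' : coalg_hom A' B') :
  a = coaction A -> b = coaction B -> sval f' = sval f ->
  @arrow (eilenberg_moore T) A' B' f' = @arrow (eilenberg_moore T) A B f.
Proof.
case: A B a a_counit aA b b_counit bA @A' @B' f f'
  => [A a' a'1 a'A] [B b' b'1 b'A] /= a a1 aA b b1 bA f f' ea eb.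
subst a' b'; move: f; rewrite -(Prop_irrelevance a1 a'1).
rewrite -(Prop_irrelevance aA a'A) -(Prop_irrelevance b1 b'1).
by rewrite -(Prop_irrelevance bA b'A) => f ef; rewrite (sval_inj ef).
Qed.

(** The counterpart for the opposite round trip, where the involution is what may change form. *)
Lemma inv_arrow_eq (M N : inv_bmod)
    (s : hom (inv_carrier M) (inv_carrier M)) sK
    (t : hom (inv_carrier N) (inv_carrier N)) tK
    (M' := @InvBmod (inv_carrier M) s sK) (N' := @InvBmod (inv_carrier N) t tK)
    (f : inv_hom M N) (f' : inv_hom M' N') :
  s = inv_sigma M -> t = inv_sigma N -> sval f' = sval f ->
  @arrow Bmods M' N' f' = @arrow Bmods M N f.
Proof.
case: M N s sK t tK @M' @N' f f'
  => [M s' s'K] [N t' t'K] /= s sK t tK f f' es et.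
subst s' t'; move: f; rewrite -(Prop_irrelevance sK s'K).
by rewrite -(Prop_irrelevance tK t'K) => f ef; rewrite (sval_inj ef).
Qed.

Lemma hom_app (M N : Bmod) (f g : hom M N) :
  f = g -> forall x : M, (f : {additive M -> N}) x = (g : {additive M -> N}) x.
Proof. by move->. Qed.

(** * The Kleisli category and pairs of morphisms *)

Section Copair.
Variables (M N : bModType) (u : bmod2_hom M N).

Definition copair_fun (x : M * M) : N := u.1 x.1 + u.2 x.2.

Fact copair_nmod_morphism : nmod_morphism copair_fun.
Proof.
split=> [|x y]; rewrite /copair_fun /= ?raddf0 ?addr0 //.
by rewrite !raddfD addrACA.
Qed.

HB.instance Definition _ :=
  GRing.isNmodMorphism.Build (M * M)%type N copair_fun copair_nmod_morphism.

Definition copair : kl_hom sqr_comonad M N :=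
  (copair_fun : {additive (M * M)%type -> N}).

End Copair.

Lemma copairK (M N : Bmod) : cancel (@copair M N) (@kleisli_pair M N).
Proof.
case=> f g; congr pair; apply: additive_eq => x /=.
  by rewrite /copair_fun /= raddf0 addr0.
by rewrite /copair_fun /= raddf0 add0r.
Qed.

Lemma kleisli_pairK (M N : Bmod) : cancel (@kleisli_pair M N) (@copair M N).
Proof.
move=> h; apply: additive_eq => -[x y] /=.
(* Additivity of [h] reduces the goal to [(x, 0) + (0, y) = (x, y)]. *)
rewrite /copair_fun /= -raddfD; congr (h _).
by congr pair; rewrite ?addr0 ?add0r.
Qed.

Lemma kleisli_pair_axioms :
  @functor_axioms (kleisli sqr_comonad) Bmod2 (fun M => M) kleisli_pair.
Proof.
split=> [M|M N P b a]; first by congr pair; apply: additive_eq.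
(* On [(x, 0)] the Kleisli composite is [b (a (x, 0), a (0, x))], and on [(0, x)] the two arguments
   of [b] are swapped. Splitting the argument of [b] along the two summands gives the two sums of
   the composition law. *)
by congr pair; apply: additive_eq => x /=;
  rewrite -raddfD; congr (b _); congr pair; rewrite /= ?addr0 ?add0r.
Qed.

(** Functoriality is inherited from [kleisli_pair], since [copair] is its inverse on each
    hom-set. *)
Lemma copair_axioms :
  @functor_axioms Bmod2 (kleisli sqr_comonad) (fun M => M) copair.
Proof.
have [p1 pM] := kleisli_pair_axioms.
split=> [M|M N P v u]; apply: (can_inj (@kleisli_pairK _ _)); rewrite copairK.
  by rewrite [RHS]p1.
by rewrite [RHS]pM !copairK.
Qed.

Lemma kleisli_cat_iso :
  cat_iso (@Functor (kleisli sqr_comonad) Bmod2 (fun M => M) kleisli_pair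
    kleisli_pair_axioms).
Proof.
exists (@Functor Bmod2 (kleisli sqr_comonad) (fun M => M) copair copair_axioms).
(* Both functors are the identity on objects, so only the bijection on hom-sets remains. *)
split; apply: functor_ext => M N f; congr arrow.
  exact: kleisli_pairK.
exact: copairK.
Qed.

(** * Coalgebras and modules with involution *)

Lemma coactionE (A : coalgebra sqr_comonad) (x : coalg_obj A) :
  (coaction A : {additive _ -> _}) x =
    (x, (coalg_sigma A : {additive _ -> _}) x).
Proof.
rewrite [LHS]surjective_pairing; congr pair.
exact: (hom_app (coaction_counit A) x).
Qed.

Lemma coalg_sigmaK (A : coalgebra sqr_comonad) :
  coalg_sigma A \oc coalg_sigma A = idc (coalg_obj A).
Proof.
apply: additive_eq => x.
apply: etrans (hom_app (coaction_counit A) x).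
(* In the last of the four components, coassociativity equates the first component of
   [coaction A x], which is the counit value, with [coalg_sigma A] applied twice to [x]. *)
exact: esym (congr1 (fun u => u.2.2) (hom_app (coactionA A) x)).
Qed.

(** This is the second component of the square defining a coalgebra morphism. *)
Lemma coalg_sigma_comm (A B : coalgebra sqr_comonad) (f : coalg_hom A B) :
  sval f \oc coalg_sigma A = coalg_sigma B \oc sval f.
Proof.
apply: additive_eq => x.
exact: esym (congr1 snd (hom_app (svalP f) x)).
Qed.

Section InvolutionCoaction.
Variable M : inv_bmod.

Definition inv_coaction_fun (x : inv_carrier M) :
  inv_carrier M * inv_carrier M := (x, (inv_sigma M : {additive _ -> _}) x).

Fact inv_coaction_nmod_morphism : nmod_morphism inv_coaction_fun.
Proof. by split=> [|x y]; rewrite /inv_coaction_fun ?raddf0 ?raddfD. Qed.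

HB.instance Definition _ :=
  GRing.isNmodMorphism.Build (inv_carrier M)
    (inv_carrier M * inv_carrier M)%type inv_coaction_fun
    inv_coaction_nmod_morphism.

Definition inv_coaction : hom (inv_carrier M) (sqr_comonad (inv_carrier M)) :=
  (inv_coaction_fun : {additive _ -> (inv_carrier M * inv_carrier M)%type}).

Fact inv_coaction_counit :
  counit sqr_comonad (inv_carrier M) \oc inv_coaction = idc (inv_carrier M).
Proof. exact: additive_eq. Qed.

Fact inv_coactionA :
  coprod sqr_comonad (inv_carrier M) \oc inv_coaction =
  fmap sqr_comonad inv_coaction \oc inv_coaction.
Proof.
(* Three of the four components agree by computation; the last one asks that [inv_sigma M] square to
   the identity. *)
apply: additive_eq => x; congr ((_, _), (_, _)).
exact: esym (hom_app (inv_sigmaK M) x).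
Qed.

Definition inv_coalgebra : coalgebra sqr_comonad :=
  Coalgebra inv_coaction_counit inv_coactionA.

Lemma coalg_sigma_inv : coalg_sigma inv_coalgebra = inv_sigma M.
Proof. exact: additive_eq. Qed.

End InvolutionCoaction.

Fact inv_coalg_hom_subproof (M N : inv_bmod) (f : inv_hom M N) :
  coaction (inv_coalgebra N) \oc sval f =
  fmap sqr_comonad (sval f) \oc coaction (inv_coalgebra M).
Proof.
apply: additive_eq => x; congr (_, _).
exact: esym (hom_app (svalP f) x).
Qed.

Definition inv_coalg_hom (M N : inv_bmod) (f : inv_hom M N) :
  coalg_hom (inv_coalgebra M) (inv_coalgebra N) :=
  exist _ _ (inv_coalg_hom_subproof f).

Lemma inv_coalg_axioms :
  @functor_axioms Bmods (eilenberg_moore sqr_comonad) inv_coalgebra inv_coalg_hom.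
Proof. by split=> *; apply: sval_inj. Qed.

Lemma inv_coactionK (A : coalgebra sqr_comonad) :
  inv_coaction (InvBmod (coalg_sigmaK A)) = coaction A.
Proof. by apply: additive_eq => x; rewrite coactionE. Qed.

Lemma coalg_inv_axioms :
  @functor_axioms (eilenberg_moore sqr_comonad) Bmods
    (fun A => InvBmod (coalg_sigmaK A))
    (fun A B f => exist _ (sval f) (coalg_sigma_comm f)).
Proof. by split=> *; apply: sval_inj. Qed.

Lemma eilenberg_moore_cat_iso :
  cat_iso (@Functor (eilenberg_moore sqr_comonad) Bmods
    (fun A => InvBmod (coalg_sigmaK A))
    (fun A B f => exist _ (sval f) (coalg_sigma_comm f)) coalg_inv_axioms).
Proof.
exists (@Functor Bmods (eilenberg_moore sqr_comonad) inv_coalgebra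
  inv_coalg_hom inv_coalg_axioms).
split; apply: functor_ext => A B f.
  by apply: coalg_arrow_eq => //; apply: inv_coactionK.
by apply: inv_arrow_eq => //; apply: coalg_sigma_inv.
Qed.

Theorem proposition3p12 :
  (exists ax : @functor_axioms (kleisli sqr_comonad) Bmod2
                 (fun M => M) kleisli_pair,
     cat_iso (@Functor (kleisli sqr_comonad) Bmod2
                (fun M => M) kleisli_pair ax))
  /\
  (exists (sigmaK : forall A : coalgebra sqr_comonad,
             coalg_sigma A \oc coalg_sigma A = idc (coalg_obj A))
          (sigma_comm : forall (A B : coalgebra sqr_comonad)
             (f : coalg_hom A B),
             sval f \oc coalg_sigma A = coalg_sigma B \oc sval f)
          (ax : @functor_axioms (eilenberg_moore sqr_comonad) Bmods
             (fun A => InvBmod (sigmaK A))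
             (fun A B f => exist _ (sval f) (sigma_comm A B f))),
     cat_iso (@Functor (eilenberg_moore sqr_comonad) Bmods
                (fun A => InvBmod (sigmaK A))
                (fun A B f => exist _ (sval f) (sigma_comm A B f)) ax)).
Proof.
split; first by exists kleisli_pair_axioms; apply: kleisli_cat_iso.
exists coalg_sigmaK, coalg_sigma_comm, coalg_inv_axioms.
exact: eilenberg_moore_cat_iso.
Qed.
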